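(* With complex powers taken with respect to the principal branch of the logarithm (so $\pi^{i} = e^{i \ln \pi}$ and $i^{\pi} = e^{\pi \operatorname{Log} i} = e^{i\pi^2/2}$), one has $$\vert \pi^i - i^{\pi} \vert = 2 \sin\left(\frac{\pi^2}{4} - \ln \sqrt{\pi}\right).$$
   Context: For a nonzero complex number $a$ and a complex number $b$, $a^b$ denotes $e^{b \operatorname{Log} a}$, where $\operatorname{Log}$ is the principal branch of the complex logarithm; in particular $\operatorname{Log} i = i\pi/2$ and $\operatorname{Log}\pi = \ln \pi$. The symbol $i$ is the imaginary unit and $\vert\cdot\vert$ is the complex modulus. *)

(* Defs.v *)
From Stdlib Require Import Reals Lra.
From Coquelicot Require Import Coquelicot.
Open Scope R_scope.

Definition Cexp (z : C) : C :=
  (exp (Re z) * cos (Im z), exp (Re z) * sin (Im z)).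

(** Principal argument of a nonzero [z], in [(- PI, PI]] ([Carg_bound],
    [Cexp_Clog]).  The test [0 <= Im z] is not strict, so that negative reals
    get [acos (-1) = PI].  The value at [0] is meaningless. *)
Definition Carg (z : C) : R :=
  if Rle_dec 0 (Im z) then acos (Re z / Cmod z) else - acos (Re z / Cmod z).

(** Principal logarithm of a nonzero [z]. *)
Definition Clog (z : C) : C := (ln (Cmod z), Carg z).

(** Principal value of [a] to the [b], for nonzero [a].  Coquelicot's [Cpow]
    only has natural exponents. *)
Definition Cpower (a b : C) : C := Cexp (b * Clog a)%C.

Lemma Cexp_plus (z w : C) : Cexp (z + w)%C = (Cexp z * Cexp w)%C.
Proof.
unfold Cexp, Cmult, Re, Im; simpl.
rewrite exp_plus, cos_plus, sin_plus.
apply injective_projections; simpl; ring.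
Qed.

Lemma Re_div_Cmod_bound (z : C) : z <> 0 -> -1 <= Re z / Cmod z <= 1.
Proof.
intros Hz.
assert (Hm : 0 < Cmod z) by (apply Cmod_gt_0; exact Hz).
generalize (re_le_Cmod z); intros H.
apply Rabs_le_between in H.
split; [apply Rle_div_r | apply Rle_div_l]; lra.
Qed.

Lemma sin_acos_Re_div_Cmod (z : C) :
  z <> 0 -> sin (acos (Re z / Cmod z)) = Rabs (Im z) / Cmod z.
Proof.
intros Hz.
assert (Hm : 0 < Cmod z) by (apply Cmod_gt_0; exact Hz).
rewrite sin_acos by (apply Re_div_Cmod_bound; exact Hz).
replace (1 - Rsqr (Re z / Cmod z)) with (Rsqr (Im z / Cmod z)).
- rewrite sqrt_Rsqr_abs, Rabs_div, (Rabs_pos_eq (Cmod z)); lra.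
- generalize (Cmod2_alt z); intros H.
  unfold Rsqr.
  replace 1 with (Cmod z ^ 2 / Cmod z ^ 2) by (field; lra).
  rewrite H at 1.
  field; lra.
Qed.

Lemma Carg_bound (z : C) : z <> 0 -> - PI < Carg z <= PI.
Proof.
intros Hz.
assert (Hm : 0 < Cmod z) by (apply Cmod_gt_0; exact Hz).
generalize (acos_bound (Re z / Cmod z)) PI_RGT_0; intros H HPI.
unfold Carg; destruct (Rle_dec 0 (Im z)) as [Hi | Hi]; [lra |].
split; [| lra].
destruct (Req_dec (acos (Re z / Cmod z)) PI) as [E | E]; [| lra].
exfalso.
generalize (sin_acos_Re_div_Cmod z Hz).
rewrite E, sin_PI, Rabs_left by lra.
intros E'.
assert (0 < - Im z / Cmod z) by (apply Rdiv_lt_0_compat; lra).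
lra.
Qed.

Lemma Cexp_Clog (z : C) : z <> 0 -> Cexp (Clog z) = z.
Proof.
intros Hz.
assert (Hm : 0 < Cmod z) by (apply Cmod_gt_0; exact Hz).
unfold Cexp, Clog; simpl.
rewrite exp_ln by exact Hm.
unfold Carg.
destruct (Rle_dec 0 (Im z)) as [Hi | Hi];
  rewrite ?cos_neg, ?sin_neg, cos_acos by (apply Re_div_Cmod_bound; exact Hz);
  rewrite sin_acos_Re_div_Cmod by exact Hz;
  [rewrite Rabs_pos_eq by lra | rewrite Rabs_left by lra];
  apply injective_projections; unfold Re, Im; simpl; field; lra.
Qed.

(* Main.v *)
Require Import Defs.
From Stdlib Require Import Reals Lra.
From Coquelicot Require Import Coquelicot.
Open Scope R_scope.

(** Both powers lie on the unit circle, [PI ^ i] at angle [ln PI] and [i ^ PI]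
    at angle [PI ^ 2 / 2], so their distance is a chord length
    [2 * Rabs (sin t)] with [t] half the difference of the angles.  The
    absolute value disappears because [t] lies in [[0, PI]], by
    [0 <= ln PI <= PI - 1] and [PI <= 4]. *)

Lemma Clog_RtoC_pos (x : R) : 0 < x -> Clog (RtoC x) = RtoC (ln x).
Proof.
intros Hx.
unfold Clog, Carg; rewrite Cmod_R, Rabs_pos_eq by lra.
unfold RtoC, Re, Im; simpl.
destruct (Rle_dec 0 0) as [_ | H]; [| lra].
replace (x / x) with 1 by (field; lra).
now rewrite acos_1.
Qed.

Lemma Cmod_Ci : Cmod Ci = 1.
Proof.
unfold Cmod, Ci; simpl.
replace (0 * (0 * 1) + 1 * (1 * 1)) with 1 by ring.
exact sqrt_1.
Qed.

Lemma Clog_Ci : Clog Ci = (0, PI / 2).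
Proof.
unfold Clog, Carg; rewrite Cmod_Ci, ln_1.
unfold Ci, Re, Im; simpl.
destruct (Rle_dec 0 1) as [_ | H]; [| lra].
now rewrite Rdiv_1_r, acos_0.
Qed.

Lemma Cpower_pos_Ci (x : R) :
  0 < x -> Cpower (RtoC x) Ci = Cexp (0, ln x).
Proof.
intros Hx.
unfold Cpower; rewrite Clog_RtoC_pos by exact Hx.
f_equal; apply injective_projections; simpl; ring.
Qed.

Lemma Cpower_Ci_RtoC (x : R) : Cpower Ci (RtoC x) = Cexp (0, x * PI / 2).
Proof.
unfold Cpower; rewrite Clog_Ci.
f_equal; apply injective_projections; simpl; field.
Qed.

(** Sum-to-product formulas pull the common factor [2 * sin ((a - b) / 2)] out of both coordinates,
    leaving the unit vector [(- sin t, cos t)] with [t = (a + b) / 2]. *)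
Lemma Cmod_Cexp_imag_minus (a b : R) :
  Cmod (Cexp (0, a) - Cexp (0, b))%C = 2 * Rabs (sin ((b - a) / 2)).
Proof.
assert (Hd : (Cexp (0, a) - Cexp (0, b))%C = (cos a - cos b, sin a - sin b)).
{ unfold Cexp, Re, Im; simpl; rewrite exp_0.
  apply injective_projections; simpl; ring. }
rewrite Hd, form2, form4.
replace ((b - a) / 2) with (- ((a - b) / 2)) by field.
rewrite sin_neg, Rabs_Ropp.
set (s := sin ((a - b) / 2)); set (t := (a + b) / 2).
unfold Cmod; simpl fst; simpl snd.
replace ((-2 * s * sin t) ^ 2 + (2 * cos t * s) ^ 2)
  with (Rsqr (2 * s) * (Rsqr (sin t) + Rsqr (cos t)))
  by (unfold Rsqr; ring).
rewrite sin2_cos2, Rmult_1_r, sqrt_Rsqr_abs, Rabs_mult.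
rewrite (Rabs_pos_eq 2); lra.
Qed.

Lemma ln_sqrt_half (x : R) : 0 < x -> ln (sqrt x) = ln x / 2.
Proof.
intros Hx.
assert (Hs : 0 < sqrt x) by (apply sqrt_lt_R0; exact Hx).
rewrite <- (sqrt_sqrt x) at 2 by lra.
rewrite ln_mult by exact Hs; field.
Qed.

(** This is [1 + y <= exp y] at [y = ln x]. *)
Lemma ln_le_minus_1 (x : R) : 0 < x -> ln x <= x - 1.
Proof.
intros Hx.
generalize (exp_ineq1_le (ln x)); rewrite exp_ln by exact Hx; lra.
Qed.

Theorem mainTheorem2 :
  Cmod (Cpower (RtoC PI) Ci - Cpower Ci (RtoC PI))%C
  = 2 * sin (PI ^ 2 / 4 - ln (sqrt PI)).
Proof.
generalize PI2_1 PI_4; intros HPI1 HPI4.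
assert (HPI : 0 < PI) by lra.
rewrite Cpower_pos_Ci by exact HPI.
rewrite Cpower_Ci_RtoC, Cmod_Cexp_imag_minus.
rewrite ln_sqrt_half by exact HPI.
replace ((PI * PI / 2 - ln PI) / 2) with (PI ^ 2 / 4 - ln PI / 2) by field.
assert (Hln : ln PI <= PI - 1) by (apply ln_le_minus_1; exact HPI).
assert (Hln0 : 0 <= ln PI) by (rewrite <- ln_1; apply ln_le; lra).
rewrite Rabs_pos_eq; [reflexivity |].
(* Below, [ln PI <= PI - 1] bounds the angle by [((PI - 1) ^ 2 + 1) / 4 > 0]; above, [0 <= ln PI]
   and [PI <= 4] give at most [PI ^ 2 / 4 <= PI]. *)
apply sin_ge_0; nra.
Qed.
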